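(* Let $n, b$ be positive integers and $d = nb$. Let $R \in \mathbb{R}^{b \times b}$ be a normalized Hadamard matrix and let $\tilde{R} = I_n \otimes R \in \mathbb{R}^{d \times d}$ be the corresponding block rotation. Given $Y = (Y_1, \ldots, Y_d) \in \mathbb{R}^d$, let $S = (S_1, \ldots, S_d)$ be a random vector with i.i.d. Rademacher entries, and define the random row vector $X \in \mathbb{R}^d$ coordinate-wise by $X_i = S_i Y_i$ for $i \in \{1,\dots,d\}$. Let $\varepsilon \in (0,1)$. Then, conditional on $Y$, $$\Vert X\tilde{R} \Vert_\infty \leq \sqrt{\frac{2}{b} \log \Big( \frac{2d}{\varepsilon} \Big) \Vert X\Vert^2_2}$$ with probability at least $1 - \varepsilon$.
   Context: A normalized Hadamard matrix $R \in \mathbb{R}^{k \times k}$ is an orthogonal matrix all of whose entries are $\pm 1/\sqrt{k}$; in particular each column $R_i$ satisfies $\Vert R_i\Vert_2 = 1$ and $\Vert R_i \Vert_\infty = 1/\sqrt{k}$. $I_n$ is the $n \times n$ identity matrix and $\otimes$ is the Kronecker product, so $I_n \otimes R = \mathrm{diag}(R,\ldots,R)$ is block diagonal with $n$ copies of $R$. A Rademacher random variable takes the values $+1$ and $-1$ with probability $1/2$ each. The vector $Y$ is given (fixed); the probability is over the random signs $S$, i.e. conditionally on $Y$ the entries of $S$ are i.i.d. Rademacher. $\log$ is the natural logarithm, and $\Vert\cdot\Vert_2$, $\Vert\cdot\Vert_\infty$ are the usual vector norms. *)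

(* Defs.v *)
From HB Require Import structures.
From mathcomp Require Import all_boot all_order all_algebra.
From mathcomp Require Import mxtens.
From mathcomp Require Import all_classical all_reals all_analysis.

Set Implicit Arguments.
Unset Strict Implicit.
Unset Printing Implicit Defensive.

Import Order.TTheory GRing.Theory Num.Theory.
Import numFieldNormedType.Exports.

Local Open Scope classical_set_scope.
Local Open Scope ring_scope.

Section Definitions.
Context (R : realType).

Definition normalized_hadamard (k : nat) (H : 'M[R]_k) : Prop :=
  H *m H^T = 1%:M /\
  forall i j, H i j = (Num.sqrt k%:R)^-1 \/ H i j = - (Num.sqrt k%:R)^-1.

(* [1%:M *t H] is the Kronecker product, [(i1 * b + i2, j1 * b + j2)] having
   entry [H i2 j2] if [i1 = j1] and [0] otherwise. *)
Definition block_rotation (n b : nat) (H : 'M[R]_b) : 'M[R]_(n * b) :=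
  (1%:M : 'M[R]_n) *t H.

(* The sup norm of a row vector is the norm [`|x|] that the library puts on
   matrices; the library has no Euclidean norm of vectors. *)
Definition l2norm (k : nat) (x : 'rV[R]_k) : R :=
  Num.sqrt (\sum_(i < k) x 0 i ^+ 2).

Section Probability.
Context (d : measure_display) (T : measurableType d) (P : probability T R).

Definition rademacher (X : {RV P >-> R}) : Prop :=
  P (X @^-1` [set 1]) = (2^-1)%:E /\ P (X @^-1` [set -1]) = (2^-1)%:E.

Definition independent_RVs (I : finType) (X : I -> {RV P >-> R}) : Prop :=
  forall (J : {set I}) (A : I -> set R), (forall i, measurable (A i)) ->
    P (\bigcap_(i in [set` J]) X i @^-1` A i)
      = (\prod_(i in J) P (X i @^-1` A i))%E.

End Probability.

End Definitions.

(* Main.v *)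
(** Each column of the block rotation has entries of square at most 1/b, so a
    coordinate of the rotated vector is a Rademacher sum with variance proxy
    v = |Y|^2 / b, where |Y| = |X| almost surely. Let c = sqrt (2 v L) with
    L = ln (2 n b / eps). Since cosh x <= exp (x^2 / 2), Chernoff's bound with
    parameter c / v makes a coordinate exceed c in absolute value with
    probability at most 2 exp (- c^2 / (2 v)) = eps / (n b), and a union bound
    over the n b coordinates concludes. All 2^(n b) sign patterns are equally
    likely, so these probabilities are counts of patterns. *)
Require Import Defs.
From HB Require Import structures.
From mathcomp Require Import all_boot all_order all_algebra.
From mathcomp Require Import mxtens.
From mathcomp Require Import all_classical all_reals all_analysis.
From mathcomp Require Import measurable_realfun ring lra.

Import Order.TTheory GRing.Theory Num.Theory.
Import numFieldNormedType.Exports.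

Local Open Scope classical_set_scope.
Local Open Scope ring_scope.

(** * The sub-Gaussian bound on cosh *)

Lemma ge0_derive_le (R : realType) (f df : R -> R) (x : R) :
  (forall y : R, is_derive y 1 f (df y)) -> (forall y, 0 <= y -> 0 <= df y) ->
  0 <= x -> f 0 <= f x.
Proof.
move=> fdf df0 x0; rewrite -subr_ge0.
have [|c] := @MVT_segment _ f df 0 x x0 (fun y _ => fdf y).
  apply: continuous_subspaceT => y.
  by apply/differentiable_continuous/derivable1_diffP; have := fdf y; case.
by rewrite in_itv/= => /andP[c0 _] ->; rewrite subr0 mulr_ge0 ?df0.
Qed.

(** By evenness take x >= 0. Then (e^z + e^-z) e^(-z^2/2) is nonincreasing for z >= 0, because z
    cosh z >= sinh z there, and it equals 2 at 0. *)
Lemma expRDN_le (R : realType) (x : R) :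
  expR x + expR (- x) <= 2 * expR (x ^+ 2 / 2).
Proof.
wlog x0 : x / 0 <= x.
  move=> h; have [/h//|/ltW x0] := leP 0 x.
  by have := h (- x); rewrite oppr_ge0 opprK sqrrN addrC; exact.
have sinh_ge0 (y : R) : 0 <= y -> 0 <= expR y - expR (- y).
  by move=> y0; rewrite subr_ge0 ler_expR; lra.
have sinh_le (y : R) : 0 <= y ->
    0 <= y * (expR y + expR (- y)) - (expR y - expR (- y)).
  move=> y0.
  (* Vanishes at 0 and has derivative z (e^z - e^-z) >= 0. *)
  pose f (z : R) := z * (expR z + expR (- z)) - (expR z - expR (- z)).
  rewrite -/(f y).
  have -> : 0 = f 0 by rewrite /f oppr0 mul0r !subrr.
  apply: (@ge0_derive_le _ f (fun z => z * (expR z - expR (- z)))) => //.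
    move=> z; rewrite /f; apply: is_derive_eq.
    by rewrite /GRing.scale/=; ring.
  by move=> z z0; rewrite mulr_ge0 ?sinh_ge0.
(* The sign turns the decrease into an increase; [sinh_le] gives the sign of the derivative. *)
pose f (z : R) := - ((expR z + expR (- z)) * expR (- (z ^+ 2 / 2))).
have : f 0 <= f x.
  apply: (@ge0_derive_le _ f (fun z =>
    (z * (expR z + expR (- z)) - (expR z - expR (- z)))
      * expR (- (z ^+ 2 / 2)))) => //.
    move=> z; rewrite /f; apply: is_derive_eq.
    by rewrite /GRing.scale/=; field.
  by move=> z z0; rewrite mulr_ge0 ?sinh_le ?expR_ge0.
rewrite /f expr0n mul0r !oppr0 !expR0 mulr1 lerN2.
by rewrite [expR (- (_ / _))]expRN ler_pdivrMr ?expR_gt0// (_ : 1 + 1 = 2).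
Qed.

(** * Chernoff bounds as counts of sign patterns *)

Section Signs.
Context (R : realType) (I : finType).
Implicit Types (a : I -> R) (s : {ffun I -> bool}).

(** Up to the factor 2^|I|, the factorization of the moment generating function: expanding the
    product picks one sign per index. *)
Lemma sum_expR_signs a :
  \sum_(s : {ffun I -> bool}) expR (\sum_i (-1) ^+ s i * a i) =
  \prod_i (expR (a i) + expR (- a i)).
Proof.
transitivity (\prod_i \sum_(e : bool) expR ((-1) ^+ e * a i)).
  by rewrite bigA_distr_bigA/=; apply: eq_bigr => s _; rewrite expR_sum.
apply: eq_bigr => i _; rewrite big_bool/= expr1 expr0 mulN1r mul1r.
exact: addrC.
Qed.

Lemma card_signs_gt a (v t : R) : 0 < v -> 0 <= t -> \sum_i a i ^+ 2 <= v ->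
  #|[pred s : {ffun I -> bool} | t < \sum_i (-1) ^+ s i * a i]|%:R <=
  2 ^+ #|I| * expR (- (t ^+ 2 / (2 * v))).
Proof.
(* This r minimizes r^2 v / 2 - r t, with minimum - t^2 / (2 v). *)
move=> v0 t0 av; set r := t / v.
have r0 : 0 <= r by rewrite divr_ge0// ltW.
(* A counted pattern contributes 1 <= exp (r (sum - t)), any other 0. *)
apply: (@le_trans _ _ (\sum_(s : {ffun I -> bool})
    expR (\sum_i (-1) ^+ s i * (r * a i)) * expR (- (r * t)))).
  rewrite -sum1_card natr_sum big_mkcond/=; apply: ler_sum => s _.
  rewrite inE; case: ifPn => [ts|_]; last by rewrite mulr_ge0 ?expR_ge0.
  rewrite -expRD -[leLHS]expR0 ler_expR.
  under eq_bigr do rewrite mulrCA.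
  by rewrite -mulr_sumr -mulrBr mulr_ge0// subr_ge0 ltW.
rewrite -mulr_suml sum_expR_signs.
apply: (@le_trans _ _ ((\prod_(i : I) (2 * expR ((r * a i) ^+ 2 / 2)))
    * expR (- (r * t)))).
  rewrite ler_wpM2r ?expR_ge0//; apply: ler_prod => i _.
  by rewrite addr_ge0 ?expR_ge0//= expRDN_le.
rewrite big_split/= prodr_const -mulrA ler_wpM2l ?exprn_ge0//.
rewrite -expR_sum -expRD ler_expR.
under eq_bigr do rewrite exprMn mulrAC.
rewrite -mulr_sumr.
apply: (@le_trans _ _ (r ^+ 2 / 2 * v - r * t)).
  by rewrite lerB// ler_wpM2l// divr_ge0 ?sqr_ge0.
by rewrite le_eqVlt; apply/orP; left; apply/eqP; rewrite /r; field; lra.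
Qed.

(** The lower tail for [a] is the upper tail for [- a], hence the factor 2. *)
Lemma card_signs_norm_gt a (v t : R) :
  0 < v -> 0 <= t -> \sum_i a i ^+ 2 <= v ->
  #|[pred s : {ffun I -> bool} | t < `|\sum_i (-1) ^+ s i * a i|]|%:R <=
  2 * (2 ^+ #|I| * expR (- (t ^+ 2 / (2 * v)))).
Proof.
move=> v0 t0 av.
set A := [pred s : {ffun I -> bool} | t < \sum_i (-1) ^+ s i * a i].
set B := [pred s : {ffun I -> bool} | t < \sum_i (-1) ^+ s i * - a i].
apply: (@le_trans _ _ (#|A|%:R + #|B|%:R)).
  rewrite -natrD ler_nat -cardUI; apply: leq_trans _ (leq_addr _ _).
  apply/subset_leq_card/fintype.subsetP => s; rewrite !inE ltr_normr.
  rewrite -sumrN; under [X in _ || (_ < X)]eq_bigr do rewrite -mulrN; exact.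
rewrite mulr_natl mulr2n lerD// card_signs_gt//.
by under eq_bigr do rewrite sqrrN.
Qed.

End Signs.

Lemma mx_norm_le {R : realType} {m k : nat} (x : 'M[R]_(m, k)) (c : R) :
  0 <= c -> (`|x| <= c) <-> (forall i j, `|x i j| <= c).
Proof.
move=> c0; rewrite [`|x|]/Num.Def.normr/= mx_normrE; split=> [h i j|h].
  by apply: le_trans h; apply/bigmax_geP; right; exists (i, j).
by apply: bigmax_le => // -[i j] _; exact: h.
Qed.


(** * From counts of patterns to probabilities *)

Section RademacherFamily.
Context (R : realType) (I : finType).
Context (d : measure_display) (T : measurableType d) (P : probability T R).
Context (S : I -> {RV P >-> R}).
Hypothesis S_rademacher : forall i, rademacher (S i).
Hypothesis S_independent : independent_RVs S.

Let pattern (s : {ffun I -> bool}) : set T :=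
  \bigcap_(i in [set` [set: I]%SET]) S i @^-1` [set (-1) ^+ s i].

Let measurable_pattern s : measurable (pattern s).
Proof.
apply: fin_bigcap_measurable => [|i _]; first exact: finite_finpred.
by apply: measurable_funPTI; exact: measurable_set1.
Qed.

Let trivIset_pattern (D : set {ffun I -> bool}) : trivIset D pattern.
Proof.
move=> s1 s2 _ _ [t [h1 h2]]; apply/ffunP => i.
have /= e1 := h1 i (finset.in_setT i); have /= := h2 i (finset.in_setT i).
by rewrite e1 => /signr_inj.
Qed.

Let prob_pattern s : P (pattern s) = (2^-1 ^+ #|I|)%:E.
Proof.
rewrite /pattern (S_independent [set: I]%SET (fun i => [set (-1) ^+ s i]))//.
rewrite (eq_bigr (fun=> (2^-1)%:E)) => [|i _].
  by rewrite prodEFin prodr_const cardsT.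
by have [] := S_rademacher i; case: (s i); rewrite ?expr1 ?expr0.
Qed.

(** [A] contains the disjoint events [pattern s] for [s] in [G], each of probability 2^-|I| by
    independence. For a lower bound, points where some [S i] is not a sign may be left out. *)
Lemma le_probability_signs (G : pred {ffun I -> bool}) (A : set T) :
  measurable A ->
  (forall s t, G s -> (forall i, S i t = (-1) ^+ s i) -> A t) ->
  ((#|G|%:R * 2^-1 ^+ #|I|)%:E <= P A)%E.
Proof.
move=> mA GA.
have -> : (#|G|%:R * 2^-1 ^+ #|I|)%:E =
    P (\bigcup_(s in [set` enum G]) pattern s).
  rewrite measure_fin_bigcup//.
  rewrite -fsbig_seq ?enum_uniq// big_enum/=.
  rewrite (eq_bigr (fun=> (2^-1 ^+ #|I|)%:E)) => [|s _]; last first.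
    exact: prob_pattern.
  by rewrite sumEFin sumr_const mulr_natl.
apply: le_measure; rewrite ?inE//.
  by apply: fin_bigcup_measurable => //; exact: finite_seq.
move=> t [s /= Gs h]; rewrite mem_enum in Gs.
apply: (GA s) => // i; exact: h i (finset.in_setT i).
Qed.

End RademacherFamily.

Lemma normalized_hadamard_sqr (R : realType) (b : nat) (H : 'M[R]_b) i j :
  normalized_hadamard H -> H i j ^+ 2 = b%:R^-1.
Proof.
by move=> [_ /(_ i j)[]->]; rewrite ?sqrrN exprVn sqr_sqrtr ?ler0n.
Qed.

(** The identity factor is 0 or 1: entries off the diagonal blocks vanish, the others are entries of
    [H]. *)
Lemma block_rotation_sqr_le (R : realType) (n b : nat) (H : 'M[R]_b) i j :
  normalized_hadamard H -> block_rotation n H i j ^+ 2 <= b%:R^-1.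
Proof.
move=> hadH; rewrite /block_rotation !mxE exprMn normalized_hadamard_sqr//.
by rewrite ler_piMl ?invr_ge0 ?ler0n//; case: eqP; rewrite ?expr1n ?expr0n.
Qed.

Lemma l2norm_sqr (R : realType) (k : nat) (x : 'rV[R]_k) :
  l2norm x ^+ 2 = \sum_i x 0 i ^+ 2.
Proof. by rewrite sqr_sqrtr// sumr_ge0// => i _; rewrite sqr_ge0. Qed.

(** * Counting the patterns that exceed the threshold *)

Section Counting.
Context (R : realType) (n b : nat) (b_gt0 : (0 < b)%N) (n_gt0 : (0 < n)%N).
Context (H : 'M[R]_b) (hadamardH : normalized_hadamard H).
Context (Y : 'rV[R]_(n * b)) (eps : R) (eps_gt0 : 0 < eps) (eps_lt1 : eps < 1).

(** A deterministic threshold: [Y] stands for X, whose norm is the same for every choice of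
    signs. *)
Let c : R := Num.sqrt (2 / b%:R * ln (2 * (n * b)%:R / eps) * l2norm Y ^+ 2).

Let sY (s : {ffun 'I_(n * b) -> bool}) : 'rV[R]_(n * b) :=
  \row_i ((-1) ^+ s i * Y 0 i).

Let ln_gt0 : 0 < ln (2 * (n * b)%:R / eps).
Proof.
rewrite ln_gt0// ltr_pdivlMr// mul1r (lt_le_trans eps_lt1)//.
by rewrite -natrM ler1n !muln_gt0 n_gt0.
Qed.

Lemma card_block_rotation_col_gt j :
  #|[pred s : {ffun 'I_(n * b) -> bool} |
     c < `|(sY s *m block_rotation n H) 0 j| ]|%:R * (n * b)%:R
  <= eps * 2 ^+ (n * b).
Proof.
have nb0 : 0 < (n * b)%:R :> R by rewrite ltr0n muln_gt0 n_gt0.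
have b0 : 0 < b%:R :> R by rewrite ltr0n.
pose a i := Y 0 i * block_rotation n H i j.
have aE s : (sY s *m block_rotation n H) 0 j = \sum_i (-1) ^+ s i * a i.
  by rewrite mxE; apply: eq_bigr => i _; rewrite [sY s 0 i]mxE mulrA.
set v := l2norm Y ^+ 2 / b%:R.
have av : \sum_i a i ^+ 2 <= v.
  rewrite /v l2norm_sqr mulr_suml; apply: ler_sum => i _.
  by rewrite exprMn ler_wpM2l ?sqr_ge0 ?block_rotation_sqr_le.
(* The Chernoff parameter c / v requires v > 0. Otherwise all [a i] vanish, and so does the
   coordinate, which cannot exceed [c]. *)
have [v0|v0] := ltP 0 v; last first.
  have a0 i : a i = 0.
    apply/eqP; rewrite -sqrf_eq0 eq_le sqr_ge0 andbT.
    rewrite (le_trans _ (le_trans av v0))// (bigD1 i)//= lerDl.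
    by rewrite sumr_ge0// => k _; rewrite sqr_ge0.
  rewrite eq_card0 ?mul0r; first by rewrite mulr_ge0 ?exprn_ge0 ?ltW.
  move=> s; rewrite !inE aE big1 => [|i _]; last by rewrite a0 mulr0.
  by rewrite normr0 ltNge sqrtr_ge0.
have Y0 : l2norm Y != 0.
  by apply/eqP => Y0; move: v0; rewrite /v Y0 expr0n mul0r ltxx.
have := @card_signs_norm_gt R _ a v c v0 (sqrtr_ge0 _) av.
rewrite card_ord.
(* The constant in [c] is chosen for this: the exponential becomes eps / (2 n b), and the two tails
   together give eps / (n b). *)
have -> : c ^+ 2 / (2 * v) = ln (2 * (n * b)%:R / eps).
  rewrite sqr_sqrtr; first by rewrite /v; field; rewrite lt0r_neq0.
  by rewrite mulr_ge0 ?sqr_ge0// mulr_ge0 ?divr_ge0// ltW.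
rewrite expRN lnK ?posrE ?divr_gt0 ?mulr_gt0//.
rewrite -ler_pdivlMr// => h.
rewrite (eq_card (B := [pred s : {ffun _ -> bool} |
    c < `|\sum_i (-1) ^+ s i * a i|])); last first.
  by move=> s; rewrite !inE aE.
apply: le_trans h _.
rewrite le_eqVlt; apply/orP; left; apply/eqP; field.
by rewrite !lt0r_neq0 ?ltr0n.
Qed.

(** Union bound: if the sup norm exceeds [c], so does some coordinate. The n b columns contribute a
    share eps / (n b) each. *)
Lemma card_block_rotation_gt :
  #|[pred s | c < `|sY s *m block_rotation n H|]|%:R <= eps * 2 ^+ (n * b).
Proof.
have nb0 : 0 < (n * b)%:R :> R by rewrite ltr0n muln_gt0 n_gt0.
rewrite -(ler_pM2r nb0).
apply: (@le_trans _ _ (\sum_(j < n * b) (#|[pred s |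
    c < `|(sY s *m block_rotation n H) 0 j| ]|%:R * (n * b)%:R))); last first.
  apply: le_trans (ler_sum _ (fun j _ => card_block_rotation_col_gt j)) _.
  by rewrite sumr_const card_ord mulr_natr.
rewrite -mulr_suml ler_pM2r//.
under eq_bigr do rewrite -sum1_card natr_sum big_mkcond/=.
(* Pairs of a pattern and a column are now summed pattern by pattern; a bad pattern has at least one
   bad column. *)
rewrite exchange_big/= -sum1_card natr_sum big_mkcond/=.
apply: ler_sum => s _; rewrite inE; case: ifPn => [|_]; last first.
  by rewrite sumr_ge0// => j _; case: ifP.
rewrite ltNge => /negP h.
have [j hj] : exists j, c < `|(sY s *m block_rotation n H) 0 j|.
  apply/not_existsP => hj; apply: h; apply/mx_norm_le; first exact: sqrtr_ge0.
  by move=> i j; rewrite ord1 leNgt; apply/negP/hj.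
rewrite (bigD1 j)//= inE hj lerDl.
by rewrite sumr_ge0// => k _; case: ifP.
Qed.

End Counting.

Theorem proposition3p4 (R : realType) (n b : nat) (n_gt0 : (0 < n)%N)
    (b_gt0 : (0 < b)%N) (H : 'M[R]_b) (hadamardH : normalized_hadamard H)
    (Y : 'rV[R]_(n * b))
    (disp : measure_display) (T : measurableType disp) (P : probability T R)
    (S : 'I_(n * b) -> {RV P >-> R})
    (S_rademacher : forall i, rademacher (S i))
    (S_independent : independent_RVs S)
    (eps : R) (eps_gt0 : 0 < eps) (eps_lt1 : eps < 1) :
  let X (t : T) : 'rV[R]_(n * b) := \row_i (S i t * Y 0 i) in
  ((1 - eps)%:E <=
    P [set t | (`|X t *m block_rotation n H|
                <= Num.sqrt (2 / b%:R * ln (2 * (n * b)%:R / eps)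
                             * l2norm (X t) ^+ 2))%R])%E.
Proof.
cbv zeta; set X := fun t : T => \row_i (S i t * Y 0 i).
have mX i : measurable_fun setT (fun t => X t 0 i).
  under eq_fun do rewrite mxE.
  by apply: measurable_funM => //; exact: measurable_funPT.
pose c t := Num.sqrt (2 / b%:R * ln (2 * (n * b)%:R / eps) * l2norm (X t) ^+ 2).
have mc : measurable_fun setT c.
  apply: (measurableT_comp (continuous_measurable_fun (@sqrt_continuous R))).
  under eq_fun do rewrite l2norm_sqr.
  apply: measurable_funM => //; apply: measurable_sum => i.
  exact: measurable_funX.
set A := (A in P A).
(* The event is a finite intersection, over coordinates, of comparisons of measurable functions; the
   threshold [c t] is itself random. *)
have mA : measurable A.
  have -> : A = \bigcap_(j in [set` [set: 'I_(n * b)]%SET])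
      [set t | `|(X t *m block_rotation n H) 0 j| <= c t].
    apply/seteqP; split => t /=.
      by move=> /(mx_norm_le _ _ (sqrtr_ge0 _)) h j _; exact: h.
    move=> h; apply/(mx_norm_le _ _ (sqrtr_ge0 _)) => i j; rewrite ord1.
    exact: h (finset.in_setT j).
  apply: fin_bigcap_measurable => [|j _]; first exact: finite_finpred.
  rewrite -[X in measurable X]setTI; apply: measurable_fun_le => //.
  apply: measurableT_comp => //.
  under eq_fun do rewrite mxE.
  by apply: measurable_sum => i; apply: measurable_funM.
pose sY (s : {ffun 'I_(n * b) -> bool}) : 'rV[R]_(n * b) :=
  \row_i ((-1) ^+ s i * Y 0 i).
pose bad := [pred s | Num.sqrt (2 / b%:R * ln (2 * (n * b)%:R / eps)
   * l2norm Y ^+ 2) < `|sY s *m block_rotation n H|].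
(* The good patterns make up a share of at least 1 - eps of all 2^(n b). *)
apply: le_trans _ (le_probability_signs _ _ _ _ _ _ S_rademacher S_independent
  [predC bad] _ mA _).
  have cardC : #|[predC bad]|%:R = 2 ^+ (n * b) - #|bad|%:R :> R.
    apply/eqP; rewrite eq_sym subr_eq addrC -natrD cardC.
    by rewrite card_ffun card_bool card_ord natrX.
  rewrite lee_fin card_ord cardC exprVn ler_pdivlMr ?exprn_gt0//.
  rewrite mulrBl mul1r lerB//; exact: card_block_rotation_gt.
move=> s t; rewrite /= -leNgt => good St.
have XE : X t = sY s by apply/rowP => i; rewrite !mxE St.
(* Signs square to 1, so on a pattern the random threshold equals the deterministic one. *)
have XY : l2norm (X t) ^+ 2 = l2norm Y ^+ 2.
  rewrite XE !l2norm_sqr; apply: eq_bigr => i _.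
  by rewrite mxE exprMn sqrr_sign mul1r.
by rewrite /A/= XY XE.
Qed.
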